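(* Let $(\mathbf{u}^h,p^h)\in\mathcal{V}^h_T\times\mathcal{Q}^h_T$ and $(\mathbf{u}',p')\in\mathcal{V}'_T\times\mathcal{Q}'_T$ be a solution of the semi-discrete Problem $(V^h)$ described in the context. Then $$(q^h,\nabla\cdot\mathbf{u}^h(t))=0\qquad\text{and}\qquad -(\nabla q^h,\mathbf{u}'(t))=0$$ for all $q^h\in\mathcal{Q}^h$ and a.e. $t\in(0,T)$.
   Context: Let $\Omega\subset\mathbb{R}^d$ be a bounded domain, $T>0$, $\nu>0$ a constant (kinematic viscosity), and $\mathbf{f}:\Omega\times(0,T)\to\mathbb{R}^d$ a source term. $(\cdot,\cdot)$ and $\|\cdot\|$ denote the $L^2(\Omega)$ inner product and norm, and $\nabla^s$ is the symmetrized gradient. Let $\mathcal{V}=(H^1_0(\Omega))^d$ and $\mathcal{Q}=L^2_0(\Omega)$ (mean-zero $L^2$ functions). Let $\mathcal{V}^h\subset\mathcal{V}$ and $\mathcal{Q}^h\subset\mathcal{Q}\cap H^1(\Omega)$ be finite-dimensional (the coarse-scale velocity and pressure spaces), forming an inf-sup stable pair, and $\mathcal{X}^h=\mathcal{V}^h\times\mathcal{Q}^h$. The fine-scale spaces are $\mathcal{V}'=(L^2(\Omega))^d$ and a finite-dimensional space $\mathcal{Q}'\subset H^1(\Omega)$ with $\mathcal{Q}^h\subseteq\mathcal{Q}'$. Let $\tau_{\text{C}}\ge 0$ and $\tau_{\text{M}}>0$ be stabilization parameters. Forms: $c(\mathbf{v}_1,\mathbf{v}_2,\mathbf{v}_3)=\int_\Omega(\mathbf{v}_1\cdot\nabla\mathbf{v}_2)\cdot\mathbf{v}_3\,d\Omega$,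 $c_{\text{cons}}(\mathbf{a},\mathbf{v}_1,\mathbf{v}_2)=-\int_\Omega\mathbf{v}_1\cdot(\mathbf{a}\cdot\nabla\mathbf{v}_2)\,d\Omega$, $c_{\text{skew}}=\tfrac12(c+c_{\text{cons}})$, $k(\mathbf{v}_1,\mathbf{v}_2)=\int_\Omega 2\nu\nabla^s\mathbf{v}_1:\nabla^s\mathbf{v}_2\,d\Omega$, $b(\mathbf{v},q)=\int_\Omega(\nabla\cdot\mathbf{v})\,q\,d\Omega$. Momentum residual: $\mathbf{r}_{\text{M}}=\partial_t\mathbf{u}^h+\mathbf{u}^h\cdot\nabla\mathbf{u}^h-\nabla\cdot(2\nu\nabla^s\mathbf{u}^h)+\nabla p^h-\mathbf{f}$; when it is not square-integrable, $(\mathbf{r}_{\text{M}},\mathbf{v}')$ denotes the sum of the $L^2$ inner products over the interiors of the mesh elements. Time-dependent spaces: $\mathcal{V}^h_T=\{\mathbf{v}\in C^0([0,T];\mathcal{V}^h):\partial_t\mathbf{v}\in L^2((0,T);\mathcal{V}^h)\}$, $\mathcal{V}'_T=\{\mathbf{v}\in C^0([0,T];\mathcal{V}'):\partial_t\mathbf{v}\in L^2((0,T);\mathcal{V}')\}$, $\mathcal{Q}^h_T=L^2((0,T);\mathcal{Q}^h)$, $\mathcal{Q}'_T=L^2((0,T);\mathcal{Q}')$. Problem $(V^h)$: find $(\mathbf{u}^h,p^h)\in\mathcal{V}^h_T\times\mathcal{Q}^h_T$ and $(\mathbf{u}',p')\in\mathcal{V}'_T\times\mathcal{Q}'_T$ with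 $\mathbf{u}^h(0)=\mathbf{u}^h_0$, $\mathbf{u}'(0)=\mathbf{u}'_0$ (given initial conditions), satisfying for a.e. $t\in(0,T)$ the coarse-scale problem \begin{align*} &(\partial_t\mathbf{u}^h(t),\mathbf{v}^h)+c_{\text{skew}}(\mathbf{u}^h(t),\mathbf{u}^h(t),\mathbf{v}^h)+k(\mathbf{u}^h(t),\mathbf{v}^h)-b(\mathbf{v}^h,p^h(t))+b(\mathbf{u}^h(t),q^h)\\ &+c_{\text{cons}}(\mathbf{u}^h(t),\mathbf{u}'(t),\mathbf{v}^h)+c_{\text{skew}}(\mathbf{u}'(t),\mathbf{u}^h(t),\mathbf{v}^h)+c_{\text{cons}}(\mathbf{u}'(t),\mathbf{u}'(t),\mathbf{v}^h)+(\partial_t\mathbf{u}'(t),\mathbf{v}^h)\\ &+(\tau_{\text{C}}\nabla\cdot\mathbf{u}^h(t),\nabla\cdot\mathbf{v}^h)=(\mathbf{f}(t),\mathbf{v}^h) \end{align*} for all $(\mathbf{v}^h,q^h)\in\mathcal{X}^h$, and the fine-scale problem \begin{align*} &(\partial_t\mathbf{u}'(t),\mathbf{v}')+(\tau_{\text{M}}^{-1}\mathbf{u}'(t),\mathbf{v}')+c(\mathbf{u}'(t),\mathbf{u}^h(t),\mathbf{v}')\\ &+(\nabla p'(t),\mathbf{v}')-(\nabla q',\mathbf{u}'(t))=-(\mathbf{r}_{\text{M}}(t),\mathbf{v}') \end{align*} for all $(\mathbf{v}',q')\in\mathcal{V}'\times\mathcal{Q}'$. *)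

(* Defs.v *)
From HB Require Import structures.
From mathcomp Require Import all_boot all_order all_algebra.
From mathcomp Require Import all_classical all_reals all_analysis.

Set Implicit Arguments.
Unset Strict Implicit.
Unset Printing Implicit Defensive.

Import Order.TTheory GRing.Theory Num.Theory.
Import numFieldNormedType.Exports.

Local Open Scope classical_set_scope.
Local Open Scope ring_scope.

Fact rV_display : measure_display. Proof. exact: default_measure_display. Qed.

(* The product sigma-algebra on row vectors, i.e. the Borel sets of R^n. *)
Section measurable_rV.
Context {R : realType} (n : nat).

Definition rV_coord (i : 'I_n) (x : 'rV[R]_n) : R := x ord0 i.

Let rV_set0 : g_sigma_preimage rV_coord set0.
Proof. exact: sigma_algebra0. Qed.

Let rV_setC A : g_sigma_preimage rV_coord A -> g_sigma_preimage rV_coord (~` A).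
Proof. exact: sigma_algebraC. Qed.

Let rV_bigcup (F : _^nat) : (forall i, g_sigma_preimage rV_coord (F i)) ->
  g_sigma_preimage rV_coord (\bigcup_i (F i)).
Proof. exact: sigma_algebra_bigcup. Qed.

HB.instance Definition _ := @isMeasurable.Build rV_display
  'rV[R]_n (g_sigma_preimage rV_coord) rV_set0 rV_setC rV_bigcup.

End measurable_rV.

Section lebesgue_rV.
Context {R : realType}.

Lemma measurable_rV_coord n (i : 'I_n) :
  measurable_fun [set: 'rV[R]_n] (rV_coord i).
Proof.
move=> _ Y mY; rewrite setTI; apply: sub_sigma_algebra => /=.
rewrite -bigcup_seq/=; exists i => /=; first by rewrite mem_index_enum.
by exists Y => //; rewrite setTI.
Qed.

Lemma measurable_fun_rVP d (T : measurableType d) n (f : T -> 'rV[R]_n) :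
  (forall i, measurable_fun [set: T] (rV_coord i \o f)) ->
  measurable_fun [set: T] f.
Proof.
move=> mf.
suff prefS : g_sigma_preimage (fun i => rV_coord i \o f) `<=` measurable.
  move=> _ A mA; apply: prefS; rewrite g_sigma_preimage_comp.
  by exists A.
apply: smallest_sub; first exact: sigma_algebra_measurable.
case: n => [|n] in f mf *; first by rewrite big_ord0.
rewrite -bigcup_mkord_ord; apply: bigcup_sub => i Ii.
by move=> A [B mB <-]; exact: mf.
Qed.

Definition cons_rV n (x : R * 'rV[R]_n) : 'rV[R]_n.+1 :=
  \row_i if unlift ord0 i is Some j then x.2 ord0 j else x.1.

Definition uncons_rV n (x : 'rV[R]_n.+1) : R * 'rV[R]_n :=
  (x ord0 ord0, \row_j x ord0 (lift ord0 j)).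

Lemma cons_rVK n : cancel (@cons_rV n) (@uncons_rV n).
Proof.
move=> [a v]; rewrite /uncons_rV mxE unlift_none; congr pair.
by apply/rowP => j; rewrite !mxE liftK.
Qed.

Lemma measurable_cons_rV n : measurable_fun [set: R * 'rV[R]_n] (@cons_rV n).
Proof.
apply: measurable_fun_rVP => i.
case: (unliftP ord0 i) => [j ->|->].
  rewrite [X in measurable_fun _ X](_ : _ = rV_coord j \o snd).
    by apply: measurableT_comp => //; exact: measurable_rV_coord.
  by apply/funext => x; rewrite /rV_coord/= mxE liftK.
rewrite [X in measurable_fun _ X](_ : _ = fst) //.
by apply/funext => x; rewrite /rV_coord/= mxE unlift_none.
Qed.

Lemma measurable_uncons_rV n :
  measurable_fun [set: 'rV[R]_n.+1] (@uncons_rV n).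
Proof.
apply: measurable_fun_pair; first exact: measurable_rV_coord.
apply: measurable_fun_rVP => i.
rewrite [X in measurable_fun _ X](_ : _ = rV_coord (lift ord0 i)).
  exact: measurable_rV_coord.
by apply/funext => x; rewrite /rV_coord/= mxE.
Qed.

Lemma sigma_finite_product d1 d2 (T1 : measurableType d1)
    (T2 : measurableType d2) (m1 : {sigma_finite_measure set T1 -> \bar R})
    (m2 : {sigma_finite_measure set T2 -> \bar R}) :
  sigma_finite setT (m1 \x m2)%E.
Proof.
have /sigma_finiteP[F [TF ndF Foo]] := sigma_finiteT m1.
have /sigma_finiteP[G [TG ndG Goo]] := sigma_finiteT m2.
exists (fun n => F n `*` G n).
  rewrite -setXTT TF TG predeqE => -[x y]; split.
    move=> [/= [n _ Fnx] [k _ Gky]]; exists (maxn n k) => //; split.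
    - by move: x Fnx; exact/subsetPset/ndF/leq_maxl.
    - by move: y Gky; exact/subsetPset/ndG/leq_maxr.
  by move=> [n _ []/= ? ?]; split; exists n.
move=> k; have [? ?] := Foo k; have [? ?] := Goo k.
split; first exact: measurableX.
by rewrite product_measure1E// lte_mul_pinfty// ge0_fin_numE.
Qed.

Section step.
Variable l : {sigma_finite_measure set (measurableTypeR R) -> \bar R}.
Variables (n : nat) (m : {sigma_finite_measure set 'rV[R]_n -> \bar R}).

Let prodm : {measure set (measurableTypeR R * 'rV[R]_n)%type -> \bar R} :=
  product_measure1 l m.

Definition lebesgue_cons : set 'rV[R]_n.+1 -> \bar R :=
  pushforward prodm (@cons_rV n).

Let lebesgue_cons0 : lebesgue_cons set0 = 0%E.
Proof. by rewrite /lebesgue_cons /pushforward preimage_set0 measure0. Qed.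

Let lebesgue_cons_ge0 A : (0 <= lebesgue_cons A)%E.
Proof. by rewrite /lebesgue_cons /pushforward. Qed.

Let lebesgue_cons_sigma_additive : semi_sigma_additive lebesgue_cons.
Proof.
have mcons A : measurable A -> measurable (@cons_rV n @^-1` A).
  by move=> mA; rewrite -[X in measurable X]setTI; exact: measurable_cons_rV.
move=> F mF tF mUF; rewrite /lebesgue_cons /pushforward preimage_bigcup.
apply: measure_semi_sigma_additive; first by move=> k; exact: mcons.
  apply/trivIsetP => /= i j _ _ ij; rewrite -preimage_setI.
  by move/trivIsetP : tF => /(_ _ _ _ _ ij) ->//; rewrite preimage_set0.
by rewrite -preimage_bigcup; exact: mcons.
Qed.

HB.instance Definition _ := isMeasure.Build _ _ _ lebesgue_cons
  lebesgue_cons0 lebesgue_cons_ge0 lebesgue_cons_sigma_additive.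

Let lebesgue_cons_sigma_finite : sigma_finite setT lebesgue_cons.
Proof.
have [F FT Foo] := sigma_finite_product l m.
exists (fun k => @uncons_rV n @^-1` F k).
  by rewrite -preimage_bigcup -FT preimage_setT.
move=> k; have [mF oo] := Foo k; split.
  by rewrite -[X in measurable X]setTI; exact: measurable_uncons_rV.
rewrite /lebesgue_cons /pushforward -comp_preimage.
by rewrite (_ : uncons_rV (n:=n) \o _ = id)//; apply/funext => x /=; rewrite cons_rVK.
Qed.

HB.instance Definition _ := Measure_isSigmaFinite.Build _ _ _ lebesgue_cons
  lebesgue_cons_sigma_finite.

End step.

(* Lebesgue measure on R^n: the n-fold product of lebesgue_measure. *)
Fixpoint lebesgue_rV (n : nat) : {sigma_finite_measure set 'rV[R]_n -> \bar R} :=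
  match n with
  | 0 => \d_(0 : 'rV[R]_0)
  | n'.+1 => lebesgue_cons (@lebesgue_measure R) (lebesgue_rV n')
  end.

Lemma lebesgue_rV_box n (A : 'I_n -> set R) : (forall i, measurable (A i)) ->
  lebesgue_rV n [set x | forall i, A i (x ord0 i)] =
  (\prod_(i < n) lebesgue_measure (A i))%E.
Proof.
elim: n A => [|n ih] A mA.
  by rewrite big_ord0 /= diracE mem_set// => -[].
rewrite big_ord_recl/= /lebesgue_cons /pushforward.
rewrite (_ : _ @^-1` _ = A ord0 `*`
    [set x : 'rV[R]_n | forall i, A (lift ord0 i) (x ord0 i)]); last first.
  apply/seteqP; split => [[a v] /= H|[a v] /= [Ha Hv] i].
    split=> [|i]; first by have := H ord0; rewrite mxE unlift_none.
    by have := H (lift ord0 i); rewrite mxE liftK.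
  by rewrite mxE; case: unliftP => [j ->|->].
rewrite -ih; last by move=> i; exact: mA.
apply: product_measure1E; first exact: mA.
rewrite [X in measurable X](_ : _ = \bigcap_(i in [set: 'I_n])
    (rV_coord i @^-1` A (lift ord0 i))); last first.
  by apply/seteqP; split=> x //= H i; [move=> _|]; apply: H.
apply: fin_bigcap_measurable => // i _.
by rewrite -[X in measurable X]setTI; exact: measurable_rV_coord.
Qed.

End lebesgue_rV.

(* All iterated directional derivatives exist everywhere and are continuous. *)
Definition smooth (R : realType) (V : normedModType R) (phi : V -> R) :=
  forall s : seq V, let D := foldr (fun v h => 'D_v h) phi s in
    continuous D /\ forall x v, derivable D x v.

Definition test_fun (R : realType) (V : normedModType R) (U : set V)
    (phi : V -> R) :=
  [/\ smooth phi, compact (closure [set x | phi x != 0]) &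
      closure [set x | phi x != 0] `<=` U].

Section sobolev.
Context {R : realType} {d : nat}.
Local Notation E := 'rV[R]_d.
Local Notation mu := (@lebesgue_rV R d).

Definition bounded_domain (Om : set E) :=
  [/\ open Om, connected Om, Om !=set0 & bounded_set Om].

Definition L2 (U : set E) (f : E -> R) :=
  measurable_fun U f /\ (\int[mu]_(x in U) (f x ^+ 2)%:E < +oo)%E.

Definition ip (U : set E) (f g : E -> R) : R := \int[mu]_(x in U) (f x * g x).

Definition weak_partial (U : set E) (j : 'I_d) (f g : E -> R) :=
  forall phi, test_fun U phi -> ip U f ('D_(delta_mx 0 j) phi) = - ip U g phi.

(* An element of H^1(Om) is a function together with a weak gradient. The weak
   gradient is unique up to null sets, so that quantifying over H1 amounts to
   quantifying over functions; quantities below depend on elements of H1 only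
   through integrals, hence only on their almost-everywhere classes. *)
Record H1 (Om : set E) := MkH1 {
  h1_fun :> E -> R ;
  grad : 'I_d -> E -> R ;
  h1_L2 : L2 Om h1_fun ;
  grad_L2 : forall j, L2 Om (grad j) ;
  gradP : forall j, weak_partial Om j h1_fun (grad j) }.

Definition h1sq (Om : set E) (f : E -> R) (g : 'I_d -> E -> R) : R :=
  ip Om f f + \sum_j ip Om (g j) (g j).

(* H^1_0(Om): the closure of the test functions in the H^1 norm. *)
Definition H10 (Om : set E) : set (H1 Om) :=
  [set v : H1 Om | forall eps : R, 0 < eps -> exists2 phi, test_fun Om phi &
    h1sq Om (v \- phi) (fun j => grad v j \- 'D_(delta_mx 0 j) phi) < eps].

(* Mean-zero functions of H^1(Om), i.e. the intersection of L^2_0 and H^1. *)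
Definition L20 (Om : set E) : set (H1 Om) :=
  [set q : H1 Om | \int[mu]_(x in Om) q x = 0].

Definition vfield := 'I_d -> E -> R.
Definition H1v (Om : set E) := 'I_d -> H1 Om.
Definition vec (Om : set E) (v : H1v Om) : vfield := fun i => v i.

Definition L2v (Om : set E) : set vfield := [set v : vfield | forall i, L2 Om (v i)].
Definition H10v (Om : set E) : set (H1v Om) :=
  [set v : H1v Om | forall i, H10 (v i)].

Definition ipv (U : set E) (v w : vfield) : R :=
  \int[mu]_(x in U) (\sum_i v i x * w i x).

Definition div (Om : set E) (v : H1v Om) (x : E) : R :=
  \sum_i grad (v i) i x.

Definition convect (Om : set E) (a : vfield) (v : H1v Om) : vfield :=
  fun i x => \sum_j a j x * grad (v i) j x.

Definition symgrad (Om : set E) (v : H1v Om) (i j : 'I_d) (x : E) : R :=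
  2^-1 * (grad (v i) j x + grad (v j) i x).

Definition h1_norm (Om : set E) (q : H1 Om) : R := Num.sqrt (h1sq Om q (grad q)).
Definition h1_dist (Om : set E) (p q : H1 Om) : R :=
  Num.sqrt (h1sq Om (p \- q) (fun j => grad p j \- grad q j)).

Definition h1v_norm (Om : set E) (v : H1v Om) : R :=
  Num.sqrt (\sum_i h1_norm (v i) ^+ 2).
Definition h1v_dist (Om : set E) (v w : H1v Om) : R :=
  Num.sqrt (\sum_i h1_dist (v i) (w i) ^+ 2).

Definition l2v_norm (Om : set E) (v : vfield) : R := Num.sqrt (ipv Om v v).
Definition l2v_dist (Om : set E) (v w : vfield) : R :=
  l2v_norm Om (fun i => v i \- w i).

(* The a.e. classes of the linear combinations of a finite family. *)

Definition findim (Om : set E) (Q : set (H1 Om)) :=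
  exists (n : nat) (b : 'I_n -> H1 Om), Q = [set q : H1 Om | exists c : 'I_n -> R,
    {ae mu, forall x, Om x -> q x = \sum_k c k * b k x}].

Definition findimv (Om : set E) (V : set (H1v Om)) :=
  exists (n : nat) (b : 'I_n -> H1v Om), V = [set v : H1v Om | exists c : 'I_n -> R,
    {ae mu, forall x, Om x -> forall i, v i x = \sum_k c k * b k i x}].

Section forms.
Variable Om : set E.

Definition form_c (v1 : vfield) (v2 : H1v Om) (v3 : vfield) : R :=
  ipv Om (convect v1 v2) v3.

Definition form_cons (a v1 : vfield) (v2 : H1v Om) : R :=
  - ipv Om v1 (convect a v2).

Definition form_skew (v1 : vfield) (v2 v3 : H1v Om) : R :=
  2^-1 * (form_c v1 v2 (vec v3) + form_cons v1 (vec v2) v3).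

Definition form_k (nu : R) (v1 v2 : H1v Om) : R :=
  \int[mu]_(x in Om)
    (\sum_i \sum_j 2 * nu * symgrad v1 i j x * symgrad v2 i j x).

Definition form_b (v : H1v Om) (q : H1 Om) : R := ip Om (div v) q.

(* The quotient is 0 when v = 0, so v = 0 does not need to be excluded. *)
Definition inf_sup_stable (Vh : set (H1v Om)) (Qh : set (H1 Om)) :=
  exists2 beta : R, 0 < beta & forall q, Qh q ->
    ((beta * Num.sqrt (ip Om q q))%:E <=
      ereal_sup [set (form_b v q / h1v_norm v)%:E | v in Vh])%E.

End forms.

(* [K] lists the interiors of the elements of a mesh of Om. *)
Definition mesh (Om : set E) (n : nat) (K : 'I_n -> set E) :=
  [/\ forall e, [/\ open (K e), K e !=set0 & K e `<=` Om],
      trivIset [set: 'I_n] K &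
      mu.-negligible (Om `\` \bigcup_e K e)].

(* The weak divergence, in L^2(U), of the vector field F (unique up to null
   sets; 0 when there is none). *)
Definition weak_div (U : set E) (F : vfield) : E -> R :=
  xget (fun=> 0) [set g | L2 U g /\ forall phi, test_fun U phi ->
    ipv U F (fun j => 'D_(delta_mx 0 j) phi) = - ip U g phi].

(* The momentum residual on an element interior U; [dtu] stands for the time
   derivative of [u]. *)
Definition residual (Om : set E) (nu : R) (U : set E) (f dtu : vfield)
    (u : H1v Om) (p : H1 Om) : vfield :=
  fun i x => dtu i x + convect (vec u) u i x
    - weak_div U (fun j y => 2 * nu * symgrad u i j y) x
    + grad p i x - f i x.

(* The pairing of the residual with v, element by element. It is the inner
   product over Om when the residual is in L^2(Om), as the element interiors
   cover Om up to a null set. *)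
Definition residual_pairing (Om : set E) (nu : R) (n : nat)
    (K : 'I_n -> set E) (f dtu : vfield) (u : H1v Om) (p : H1 Om)
    (v : vfield) : R :=
  \sum_e ipv (K e) (residual nu (K e) f dtu u p) v.

End sobolev.
Arguments vfield R d : clear implicits.

Section time.
Context {R : realType}.

(* X is a space with norm [nrm] and distance [dist], S a subspace of X. *)
Section bochner.
Variables (X : Type) (nrm : X -> R) (dist : X -> X -> R) (S : set X) (T : R).

(* Strong measurability on ]0, T[ of an S-valued function: almost everywhere
   limit of measurable functions with finitely many values in S. *)
Definition strongly_measurable (u : R -> X) :=
  exists s : nat -> R -> X,
    (forall n, [/\ forall t, S (s n t), finite_set (range (s n)) &
       forall x, measurable (s n @^-1` [set x])]) /\
    {ae @lebesgue_measure R, forall t, 0 < t < T ->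
      dist (s n t) (u t) @[n --> \oo] --> 0}.

Definition L2T (u : R -> X) :=
  [/\ {ae @lebesgue_measure R, forall t, 0 < t < T -> S (u t)},
      strongly_measurable u &
      (\int[@lebesgue_measure R]_(t in `]0%R, T[) (nrm (u t) ^+ 2)%:E < +oo)%E].

Definition C0T (u : R -> X) :=
  forall t, 0 <= t <= T -> S (u t) /\
    dist (u s) (u t) @[s --> within `[0, T] (nbhs t)] --> 0.

End bochner.

Context {d : nat}.
Implicit Types Om : set 'rV[R]_d.

(* [dtu] is the weak derivative in time of [u] on ]0, T[, both being regarded
   as functions with values in L^2(Om)^d. *)
Definition weak_dt Om (T : R) (u dtu : R -> vfield R d) :=
  forall phi psi, test_fun `]0, T[ phi -> L2v Om psi ->
    \int[lebesgue_measure]_(t in `]0, T[) (ipv Om (u t) psi * 'D_1 phi t) =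
    - \int[lebesgue_measure]_(t in `]0, T[) (ipv Om (dtu t) psi * phi t).

Definition VhT Om (Vh : set (H1v Om)) (T : R) (u dtu : R -> H1v Om) :=
  [/\ C0T (@h1v_dist _ _ Om) Vh T u,
      L2T (@h1v_norm _ _ Om) (@h1v_dist _ _ Om) Vh T dtu &
      weak_dt Om T (fun t => vec (u t)) (fun t => vec (dtu t))].

Definition VpT Om (T : R) (u dtu : R -> vfield R d) :=
  [/\ C0T (l2v_dist Om) (L2v Om) T u,
      L2T (l2v_norm Om) (l2v_dist Om) (L2v Om) T dtu &
      weak_dt Om T u dtu].

(* All norms of a finite-dimensional subspace of H^1(Om) being equivalent, it
   does not matter that it is the H^1 norm that is used here. *)
Definition QT Om (Q : set (H1 Om)) (T : R) (p : R -> H1 Om) :=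
  L2T (@h1_norm _ _ Om) (@h1_dist _ _ Om) Q T p.

End time.

(* [up] and [pp] are the fine-scale velocity and pressure u' and p'. Integrals
   are total: no integrability of the nonlinear terms is required. *)
Record solution (R : realType) (d : nat) (Om : set 'rV[R]_d) (T nu : R)
    (f : R -> vfield R d) (n : nat) (K : 'I_n -> set 'rV[R]_d)
    (Vh : set (H1v Om)) (Qh Qp : set (H1 Om))
    (tauC tauM : R -> 'rV[R]_d -> R)
    (uh0 : H1v Om) (up0 : vfield R d)
    (uh dtuh : R -> H1v Om) (ph : R -> H1 Om)
    (up dtup : R -> vfield R d) (pp : R -> H1 Om) : Prop := {
  sol_uh : VhT Vh T uh dtuh ;
  sol_ph : QT Qh T ph ;
  sol_up : VpT Om T up dtup ;
  sol_pp : QT Qp T pp ;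
  sol_uh0 : {ae lebesgue_rV d, forall x, Om x -> forall i,
    uh 0 i x = uh0 i x} ;
  sol_up0 : {ae lebesgue_rV d, forall x, Om x -> forall i,
    up 0 i x = up0 i x} ;
  sol_coarse : {ae @lebesgue_measure R, forall t, 0 < t < T ->
    forall vh qh, Vh vh -> Qh qh ->
      ipv Om (vec (dtuh t)) (vec vh)
      + form_skew (vec (uh t)) (uh t) vh
      + form_k nu (uh t) vh
      - form_b vh (ph t)
      + form_b (uh t) qh
      + form_cons (vec (uh t)) (up t) vh
      + form_skew (up t) (uh t) vh
      + form_cons (up t) (up t) vh
      + ipv Om (dtup t) (vec vh)
      + ip Om (fun x => tauC t x * div (uh t) x) (div vh)
      = ipv Om (f t) (vec vh)} ;
  sol_fine : {ae @lebesgue_measure R, forall t, 0 < t < T ->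
    forall vp qp, L2v Om vp -> Qp qp ->
      ipv Om (dtup t) vp
      + ipv Om (fun i x => (tauM t x)^-1 * up t i x) vp
      + form_c (up t) (uh t) vp
      + ipv Om (grad (pp t)) vp
      - ipv Om (grad qp) (up t)
      = - residual_pairing nu K (f t) (vec (dtuh t)) (uh t) (ph t) vp} }.

(* Main.v *)
(* The equations are affine in the pressure test functions, and the null
   function is an admissible pressure: comparing each equation tested with
   [(v, q)] and with [(v, 0)] isolates the term in [q]. *)
Require Import Defs.
From mathcomp Require Import all_boot all_order all_algebra.
From mathcomp Require Import all_classical all_reals all_analysis.
From mathcomp Require Import lra.

Set Implicit Arguments.
Unset Strict Implicit.
Unset Printing Implicit Defensive.

Import Order.TTheory GRing.Theory Num.Theory.
Import numFieldNormedType.Exports.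

Local Open Scope classical_set_scope.
Local Open Scope ring_scope.

Section zero_pressure.
Context {R : realType} {d : nat}.
Implicit Type Om : set 'rV[R]_d.

Lemma ip0l Om (g : 'rV[R]_d -> R) : ip Om (fun=> 0) g = 0.
Proof.
rewrite /ip; under eq_Rintegral do rewrite mul0r.
by rewrite /Rintegral integral0.
Qed.

Lemma ipC Om (f g : 'rV[R]_d -> R) : ip Om f g = ip Om g f.
Proof. by apply: eq_Rintegral => x _; rewrite mulrC. Qed.

Lemma ipv0l Om (v : vfield R d) : ipv Om (fun _ _ => 0) v = 0.
Proof.
rewrite /ipv; under eq_Rintegral do
  (under eq_bigr do rewrite mul0r; rewrite big1_eq).
by rewrite /Rintegral integral0.
Qed.

Lemma L2_0 Om : L2 Om (fun=> 0 : R).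
Proof.
split; first exact: measurable_cst.
by under eq_integral do rewrite expr0n/=; rewrite integral0.
Qed.

Lemma weak_partial0 Om (j : 'I_d) : weak_partial Om j (fun=> 0) (fun=> 0 : R).
Proof. by move=> phi _; rewrite !ip0l oppr0. Qed.

(** The weak gradient paired with the null function is the null field itself, not just a field
    vanishing almost everywhere, so [grad (H1_0 Om)] computes to zero. *)
Definition H1_0 Om : H1 Om :=
  MkH1 (L2_0 Om) (fun=> L2_0 Om) (@weak_partial0 Om).

Lemma form_b0 Om (v : H1v Om) : form_b v (H1_0 Om) = 0.
Proof. by rewrite /form_b ipC ip0l. Qed.

(** All coefficients are taken null. Membership only constrains the function almost everywhere, so
    this particular representative of zero belongs to [Q]. *)
Lemma findim0 Om (Q : set (H1 Om)) : findim Q -> Q (H1_0 Om).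
Proof.
move=> [n [b ->]]; exists (fun=> 0); apply: aeW => x _ /=.
by rewrite big1// => k _; rewrite mul0r.
Qed.

End zero_pressure.

Theorem lemma1 (R : realType) (d : nat) (Om : set 'rV[R]_d) (T nu : R)
    (f : R -> vfield R d) (n : nat) (K : 'I_n -> set 'rV[R]_d)
    (Vh : set (H1v Om)) (Qh Qp : set (H1 Om))
    (tauC tauM : R -> 'rV[R]_d -> R)
    (uh0 : H1v Om) (up0 : vfield R d)
    (uh dtuh : R -> H1v Om) (ph : R -> H1 Om)
    (up dtup : R -> vfield R d) (pp : R -> H1 Om)
    (d_gt0 : (0 < d)%N) (Om_domain : bounded_domain Om)
    (T_gt0 : 0 < T) (nu_gt0 : 0 < nu) (K_mesh : mesh Om K)
    (Vh_findim : findimv Vh) (Vh_H10 : Vh `<=` @H10v R d Om)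
    (Qh_findim : findim Qh) (Qh_L20 : Qh `<=` @L20 R d Om)
    (Vh_Qh_stable : inf_sup_stable Vh Qh)
    (Qp_findim : findim Qp) (Qh_Qp : Qh `<=` Qp)
    (tauC_ge0 : forall t x, 0 < t < T -> Om x -> 0 <= tauC t x)
    (tauM_gt0 : forall t x, 0 < t < T -> Om x -> 0 < tauM t x)
    (uh0_Vh : Vh uh0) (up0_Vp : L2v Om up0)
    (sol : solution T nu f K Vh Qh Qp tauC tauM uh0 up0
             uh dtuh ph up dtup pp) :
  {ae @lebesgue_measure R, forall t, 0 < t < T -> forall qh, Qh qh ->
    ip Om qh (div (uh t)) = 0 /\ - ipv Om (grad qh) (up t) = 0}.
Proof.
have Qh0 := findim0 Qh_findim.
have [_ _ _ _ _ _ coarse fine] := sol.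
(* The two exceptional null sets of times are fixed before [qh] is chosen, so their union serves
   every [qh]. *)
move: coarse fine; apply: filterS2.
  exact: (ae_filter_ringOfSetsType (@lebesgue_measure R)).
move=> t coarse_t fine_t tT qh Qh_qh; split.
  (* Any velocity in [Vh] would do; the initial datum is one at hand. Both equations share the
     right-hand side [ipv Om (f t) (vec uh0)]. *)
  have := coarse_t tT _ _ uh0_Vh Qh_qh.
  rewrite -(coarse_t tT _ _ uh0_Vh Qh0) form_b0 (ipC Om qh) -/(form_b _ _).
  lra.
(* The inclusion of [Qh] in [Qp] makes [qh] and zero admissible fine-scale pressures; the residual
   pairing is the same for both. *)
have := fine_t tT _ _ up0_Vp (Qh_Qp _ Qh_qh).
rewrite -(fine_t tT _ _ up0_Vp (Qh_Qp _ Qh0)) ipv0l.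
lra.
Qed.
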